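(* Let $k\ge 3$ and $n\ge 2$ be integers and let $\mathcal{H}_{k,n}$ be the hinge graph obtained by gluing $n$ copies of the $k$-cycle along one common edge. Then $$K(\mathcal{H}_{k,n})\cong (\mathbb{Z}/(k-1)\mathbb{Z})^{n-2}\oplus \mathbb{Z}/(k^2+nk-2k-n+1)\mathbb{Z}.$$
   Context: The hinge graph $\mathcal{H}_{k,n}$ is the simple graph with two distinguished vertices $x,y$ joined by an edge $xy$, together with $n$ internally vertex-disjoint paths from $x$ to $y$, each having $k-2$ internal vertices (equivalently, $n$ copies of the $k$-cycle glued along a common edge). The critical group $K(G)$ of a finite connected graph $G$ is the group of degree-zero divisors (formal $\mathbb{Z}$-combinations of vertices with coefficient sum $0$) modulo the image of the graph Laplacian, i.e., the torsion part of the cokernel of the Laplacian. *)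

(* Defs.v *)
From HB Require Import structures.
From mathcomp Require Import all_boot all_order all_algebra ring_quotient.
From mathcomp Require Import boolp.

Set Implicit Arguments.
Unset Strict Implicit.
Unset Printing Implicit Defensive.

Import Order.TTheory GRing.Theory Num.Theory.
Local Open Scope ring_scope.

Record sgraph := SGraph {
  vertex :> finType;
  adj : rel vertex;
  adj_sym : symmetric adj;
  adj_irr : irreflexive adj }.

Definition sgraph_connected (G : sgraph) : Prop :=
  (0 < #|G|)%N /\ forall u v : G, connect (@adj G) u v.

Section CriticalGroup.
Variable G : sgraph.

Local Notation divisor := {ffun G -> int}.

Definition divisor_deg (D : divisor) : int := \sum_v D v.

Definition degree (v : G) : nat := #|[pred w | adj v w]|.

Definition laplacian (f : divisor) : divisor :=
  [ffun v => f v *+ degree v - \sum_(w | adj v w) f w].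

Lemma laplacianB (f g : divisor) :
  laplacian (f - g) = laplacian f - laplacian g.
Proof.
apply/ffunP=> v; rewrite !ffunE mulrnBl.
under eq_bigr do rewrite !ffunE.
by rewrite sumrB opprD addrACA -opprD.
Qed.

Lemma laplacian_deg0 (f : divisor) : divisor_deg (laplacian f) = 0.
Proof.
rewrite /divisor_deg; under eq_bigr do rewrite ffunE.
rewrite sumrB; apply/eqP; rewrite subr_eq0; apply/eqP.
rewrite [RHS](exchange_big_dep predT) //=; apply: eq_bigr => v _.
rewrite -sumr_const; apply: eq_bigl => w.
by rewrite inE adj_sym.
Qed.

Definition deg0 : {pred divisor} := [pred D | divisor_deg D == 0].

Fact deg0_zmod_closed : zmod_closed deg0.
Proof.
split=> [|D E]; rewrite !inE /divisor_deg.
  by rewrite big1 // => v _; rewrite ffunE.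
move=> /eqP D0 /eqP E0; under eq_bigr do rewrite !ffunE.
by rewrite sumrB D0 E0 subrr.
Qed.
HB.instance Definition _ :=
  GRing.isZmodClosed.Build divisor deg0 deg0_zmod_closed.

Record divisor0 := Divisor0 { divisor0_val :> divisor; _ : deg0 divisor0_val }.
HB.instance Definition _ := [isSub for divisor0_val].
HB.instance Definition _ := [Choice of divisor0 by <:].
HB.instance Definition _ := [SubChoice_isSubZmodule of divisor0 by <:].

Definition principal : {pred divisor0} :=
  [pred D | `[< exists f : divisor, divisor0_val D = laplacian f >]].

Fact principal_zmod_closed : zmod_closed principal.
Proof.
split=> [|D E]; rewrite !inE.
  by apply/asboolP; exists 0; rewrite -[0 in RHS](subrr 0) laplacianB subrr.
move=> /asboolP[f Df] /asboolP[g Eg]; apply/asboolP.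
by exists (f - g); rewrite laplacianB -Df -Eg.
Qed.
HB.instance Definition _ :=
  GRing.isZmodClosed.Build divisor0 principal principal_zmod_closed.

(* [Quotient.quot] only needs a subgroup of a [zmodType]; although it is
   also used for ideals, no ring structure is involved here. *)
Definition critical_group : zmodType := @Quotient.quot divisor0 principal.

End CriticalGroup.

(* The vertices x, y are [inl false], [inl true]; [inr (i, j)] is the j-th
   internal vertex (from x, starting at 0) of the i-th path. *)
Section Hinge.
Variables k n : nat.

Definition hinge_vertex : finType := (bool + 'I_n * 'I_(k - 2))%type.

Definition hinge_arc : rel hinge_vertex := fun u v =>
  match u, v with
  | inl false, inl true => true
  | inl false, inr (_, j) => j == 0%N :> nat
  | inr (i, j), inr (i', j') => (i == i') && (j' == j.+1 :> nat)
  | inr (_, j), inl true => j.+1 == (k - 2)%N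
  | _, _ => false
  end.

Definition hinge_adj : rel hinge_vertex :=
  fun u v => hinge_arc u v || hinge_arc v u.

Fact hinge_adj_sym : symmetric hinge_adj.
Proof. by move=> u v; rewrite /hinge_adj orbC. Qed.

Fact hinge_adj_irr : irreflexive hinge_adj.
Proof.
rewrite /hinge_adj => -[[]|[i j]] //=.
by rewrite eqxx orbb ltn_eqF.
Qed.

Definition hinge : sgraph := SGraph hinge_adj_sym hinge_adj_irr.

Lemma hinge_connected : sgraph_connected hinge.
Proof.
split; first by apply/card_gt0P; exists (inl true).
have x_to v : connect hinge_adj (inl false) v.
  case: v => [[]|[i [j lt_j]]]; [exact: connect1 | exact: connect0 |].
  elim: j lt_j => [|j IHj] lt_j; first exact: connect1.
  apply: connect_trans (IHj (ltnW lt_j)) _; apply: connect1.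
  by rewrite /hinge_adj /= !eqxx.
move=> u v; apply: connect_trans (x_to v).
by rewrite (sym_connect_sym hinge_adj_sym).
Qed.

End Hinge.

(* Main.v *)
(* Put m = k - 1 and let A_i(D) be the sum over the interior vertices v of the
   i-th path of D(v) times the distance from x to v.  Summation by parts gives
   A_i(Lf) = m (f(y_i) - f(y)) + s, with y_i the neighbour of y on that path and
   s = f(y) - f(x).  Hence a divisor D of degree 0 is principal iff some integer
   s satisfies s = A_i(D) mod m for all i, and
   (m + n) s = sum_i A_i(D) + m D(y); conversely, such an s lets one solve the
   second-order recurrence Lf = D along every path.  Eliminating s, D is
   principal iff m divides A_l - A_last for the first n - 2 indices l and
   m (m + n) divides sum_i A_i + m D(y) - (m + n) A_last.  These n - 1 integers
   are the components of the isomorphism; k^2 + nk - 2k - n + 1 = m (m + n). *)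
Require Import Defs.
From HB Require Import structures.
From mathcomp Require Import all_boot all_order all_algebra ring_quotient.
From mathcomp Require Import boolp zify ring.

Set Implicit Arguments.
Unset Strict Implicit.
Unset Printing Implicit Defensive.

Import Order.TTheory GRing.Theory Num.Theory.
Local Open Scope ring_scope.

(** * The Laplacian of the hinge graph in path coordinates *)

Lemma laplacianE (G : sgraph) (f : {ffun G -> int}) v :
  laplacian f v = \sum_(w | adj v w) (f v - f w).
Proof. by rewrite ffunE sumrB sumr_const. Qed.

Section HingeLaplacian.
Variables k n : nat.
Local Notation V := (hinge_vertex k n).
Implicit Types (f D : {ffun hinge k n -> int}).

Lemma hinge_sum (F : V -> int) :
  \sum_v F v = F (inl true) + F (inl false) + \sum_i \sum_j F (inr (i, j)).
Proof.
rewrite big_sumType big_bool pair_bigA /=; congr (_ + _).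
by apply: eq_bigr => -[].
Qed.

(* The vertex at distance [a] from x along the i-th path, for [a < k]. *)
Definition path_vertex (i : 'I_n) (a : nat) : V :=
  if a is b.+1 then
    if insub b is Some j then inr (i, j) else inl true
  else inl false.

Lemma path_vertex_x i a : (inl false == path_vertex i a) = (a == 0)%N.
Proof. by case: a => //= a; case: insubP. Qed.

(** An inequality, because an index past the interior falls back on y when [insub] fails. *)
Lemma path_vertex_y i a : (inl true == path_vertex i a) = (k - 2 < a)%N.
Proof.
case: a => //= a; case: insubP => [j lt_a _|lt_a]; apply/esym.
  by apply/negbTE; lia.
by rewrite eqxx; lia.
Qed.

Lemma path_vertex_inner i a i' (j : 'I_(k - 2)) :
  (inr (i', j) == path_vertex i a) = (i' == i) && (a == j.+1).
Proof.
case: a => [|a] /=; first by rewrite andbF.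
case: insubP => [l lt_a <-|].
  by rewrite -[LHS]/((i', j) == (i, l)) xpair_eqE eqSS (eq_sym (l : nat)).
rewrite -leqNgt => le_a; rewrite eqSS gtn_eqF ?andbF //.
exact: leq_trans le_a.
Qed.

Lemma path_vertex_ord i (j : 'I_(k - 2)) : path_vertex i j.+1 = inr (i, j).
Proof. by apply/esym/eqP; rewrite path_vertex_inner !eqxx. Qed.

Lemma path_vertex_end i : path_vertex i (k - 2).+1 = inl true.
Proof. by apply/esym/eqP; rewrite path_vertex_y. Qed.

Arguments path_vertex : simpl never.

Lemma hinge_adj_inner i (j : 'I_(k - 2)) :
  hinge_adj (inr (i, j)) =1 pred2 (path_vertex i j) (path_vertex i j.+2).
Proof.
have lt_j := ltn_ord j.
move=> [[]|[i' j']]; rewrite /hinge_adj /=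
  ?path_vertex_x ?path_vertex_y ?path_vertex_inner.
- by rewrite orbF; lia.
- by rewrite orbF.
- by rewrite (eq_sym i) orbC -!andb_orr !eqSS (eq_sym (j' : nat)).
Qed.

Lemma laplacian_inner f i (j : 'I_(k - 2)) :
  laplacian f (inr (i, j)) =
    f (path_vertex i j.+1) *+ 2 - f (path_vertex i j) - f (path_vertex i j.+2).
Proof.
rewrite laplacianE (eq_bigl _ _ (hinge_adj_inner i j)) path_vertex_ord.
have neq : path_vertex i j.+2 != path_vertex i j.
  apply/eqP; case: j => -[|j] lt_j /= E.
    by have := path_vertex_x i 2; rewrite E.
  have lt_j' : (j < k - 2)%N := ltnW lt_j.
  have := path_vertex_inner i j.+3 i (Ordinal lt_j').
  by rewrite E path_vertex_inner eqxx /=; lia.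
rewrite (bigD1 (path_vertex i j)) /= ?eqxx // (big_pred1 (path_vertex i j.+2)).
  by ring.
move=> w /=; case: (w =P path_vertex i j.+2) => [->|_] /=.
  by rewrite neq orbT.
by rewrite orbF andbN.
Qed.

Hypothesis hk : (2 < k)%N.

Lemma laplacian_x f :
  laplacian f (inl false) = f (inl false) - f (inl true)
    + \sum_i (f (inl false) - f (path_vertex i 1)).
Proof.
rewrite laplacianE big_mkcond hinge_sum /= addr0; congr (_ + _).
have k2_gt0 : (0 < k - 2)%N by rewrite subn_gt0.
apply: eq_bigr => i _; rewrite (path_vertex_ord i (Ordinal k2_gt0)).
rewrite -big_mkcond (big_pred1 (Ordinal k2_gt0)) // => j.
by rewrite /hinge_adj /= orbF.
Qed.

Lemma laplacian_y f :
  laplacian f (inl true) = f (inl true) - f (inl false)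
    + \sum_i (f (inl true) - f (path_vertex i (k - 2))).
Proof.
rewrite laplacianE big_mkcond hinge_sum /= add0r; congr (_ + _).
have lt_k : (k - 3 < k - 2)%N by lia.
have k2E : (k - 2)%N = (Ordinal lt_k).+1 by rewrite /=; lia.
apply: eq_bigr => i _; rewrite [in path_vertex i _]k2E path_vertex_ord.
rewrite -big_mkcond (big_pred1 (Ordinal lt_k)) // => j.
by rewrite /hinge_adj /= -val_eqE /=; lia.
Qed.

(** * Path moments and the criterion for principal divisors *)

(* The weight [j.+1] is the distance from x along the path. *)
Definition path_moment D (i : 'I_n) : int :=
  \sum_(j < k - 2) D (inr (i, j)) *+ j.+1.

Lemma path_moment_laplacian f i :
  path_moment (laplacian f) i =
    (f (path_vertex i (k - 2)) - f (inl true)) *+ (k - 1)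
      + (f (inl true) - f (inl false)).
Proof.
rewrite /path_moment; under eq_bigr do rewrite laplacian_inner.
rewrite -(path_vertex_end i) -[inl false]/(path_vertex i 0).
have -> : (k - 1)%N = (k - 2).+1 by lia.
pose h a := f (path_vertex i a).
(* The upper limit is freed so that induction applies; [p = k - 2] is the case needed. *)
have sum_by_parts p : \sum_(j < p) (h j.+1 *+ 2 - h j - h j.+2) *+ j.+1 =
    (h p - h p.+1) *+ p.+1 + (h p.+1 - h 0%N).
  elim: p => [|p IHp]; first by rewrite big_ord0; ring.
  by rewrite big_ord_recr /= IHp; ring.
exact: sum_by_parts.
Qed.

(** Both sides have degree 0, so their values at y are determined by the others. *)
Lemma laplacian_eq_off_y f D :
  divisor_deg D = 0 -> (forall v, v != inl true -> laplacian f v = D v) ->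
  laplacian f = D.
Proof.
move=> D0 fD; apply/ffunP => v; have [->|/fD//] := eqVneq v (inl true).
have := laplacian_deg0 f; rewrite -D0 /divisor_deg.
rewrite (bigD1 (inl true)) //= [RHS](bigD1 (inl true)) //=.
by rewrite (eq_bigr D) => [|w /fD //]; apply: addIr.
Qed.

Lemma path_momentB D E i :
  path_moment (D - E) i = path_moment D i - path_moment E i.
Proof.
by rewrite -sumrB; apply: eq_bigr => j _; rewrite !ffunE mulrnBl.
Qed.

(** Put [c i] on the neighbour of x, which has weight 1, and balance the degree at x, which enters
    no moment. *)
Lemma path_moment_surj (c : 'I_n -> int) :
  exists D, [/\ divisor_deg D = 0, D (inl true) = 0 & path_moment D =1 c].
Proof.
pose D0 (v : V) : int := match v with
  | inl true => 0 | inl false => - \sum_i c i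
  | inr (i, j) => c i *+ (val j == 0)%N end.
exists [ffun v => D0 v]; have k2_gt0 : (0 < k - 2)%N by lia.
have sum_path (g : 'I_(k - 2) -> int) :
    (forall j, val j != 0%N -> g j = 0) -> \sum_j g j = g (Ordinal k2_gt0).
  by move=> g0; rewrite (bigD1 (Ordinal k2_gt0)) //= big1 ?addr0.
split=> [||i]; rewrite ?ffunE //.
  rewrite /divisor_deg hinge_sum !ffunE /= add0r.
  apply/eqP; rewrite addrC addr_eq0 opprK; apply/eqP/eq_bigr => i _.
  by rewrite sum_path /= ?ffunE // => j /negbTE j0; rewrite ffunE /= j0.
rewrite /path_moment sum_path /= ?ffunE // => j /negbTE j0.
by rewrite ffunE /= j0 mul0rn.
Qed.

Lemma principalP D : divisor_deg D = 0 ->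
  (exists f, D = laplacian f) <->
  (exists s, (forall i, ((k - 1)%:Z %| path_moment D i - s)%Z) /\
     s *+ (k - 1 + n) = \sum_i path_moment D i + D (inl true) *+ (k - 1)).
Proof.
move=> D0; split=> [[f ->]|[s [s_mod s_sum]]].
  exists (f (inl true) - f (inl false)); split=> [i|].
    rewrite path_moment_laplacian addrK -mulr_natr natz; exact: dvdz_mull.
  rewrite laplacian_y; under eq_bigr do rewrite path_moment_laplacian.
  rewrite big_split /= sumr_const card_ord sumrMnl.
  under eq_bigr do rewrite -opprB.
  by rewrite sumrN; ring.
pose d i (j : 'I_(k - 2)) := D (inr (i, j)).
(* The distances of an interior vertex to x and to y add up to [k - 1]. *)
have moment_compl i :
    \sum_j d i j *+ (k - 2 - j) + path_moment D i = (\sum_j d i j) *+ (k - 1).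
  rewrite -big_split -sumrMnl; apply: eq_bigr => j _ /=.
  by rewrite -mulrnDr; congr (_ *+ _); have := ltn_ord j; lia.
(* Normalise [f] to 0 at x. Then [t i] is its value at the first interior vertex, and the equation
   says that the recurrence along the path reaches y with value [s]. *)
have /fin_all_exists[t t_def] i :
    exists t, t *+ (k - 1) - \sum_j d i j *+ (k - 2 - j) = s.
  have /dvdzP[q q_def] := s_mod i; exists (\sum_j d i j - q).
  have := moment_compl i; move/eqP: q_def.
  rewrite -natz mulr_natr subr_eq mulrnBl => /eqP-> <-; ring.
(* With truncated subtraction, a |-> a - (j + 1) has second difference 1 at
   a = j and 0 elsewhere. *)
pose h i a := t i *+ a - \sum_j d i j *+ (a - j.+1).
pose f0 (v : V) : int :=
  match v with inl false => 0 | inl true => s | inr (i, j) => h i j.+1 end.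
pose f : {ffun hinge k n -> int} := [ffun v => f0 v].
have f_path i a : (a < k)%N -> f (path_vertex i a) = h i a.
  case: a => [_|a lt_a].
    by rewrite ffunE /h mulr0n big1 ?subr0 // => j _; rewrite mulr0n.
  have [lt_a2|] := ltnP a (k - 2).
    by rewrite (path_vertex_ord i (Ordinal lt_a2)) ffunE.
  move=> le_a; have -> : a = (k - 2)%N by lia.
  rewrite path_vertex_end ffunE /= -(t_def i) /h; congr (_ *+ _ - _); lia.
have f_inner i j : laplacian f (inr (i, j)) = d i j.
  have lt_j := ltn_ord j; rewrite laplacian_inner !f_path /h; try lia.
  suff : \sum_l d i l *+ (j - l.+1) + \sum_l d i l *+ (j.+2 - l.+1) =
         (\sum_l d i l *+ (j.+1 - l.+1)) *+ 2 + d i j.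
    by move/eqP; rewrite addrC eq_sym -subr_eq => /eqP <-; ring.
  rewrite -[d i j](big_pred1_eq +%R) [in RHS]big_mkcond -sumrMnl -!big_split /=.
  apply: eq_bigr => l _; have [->|] := eqVneq l j.
    by rewrite subnn subSnn (_ : j - j.+1 = 0)%N //; lia.
  rewrite -val_eqE /= => neq_l; rewrite addr0 -mulrnDr -mulrnA.
  by congr (_ *+ _); lia.
(* Interior vertices are settled by [f_inner], so only x remains. *)
exists f; apply/esym/laplacian_eq_off_y => // -[[]|[i j]] // _.
have fx i : f (inl false) - f (path_vertex i 1) = - t i.
  rewrite f_path /h; last by lia.
  by rewrite ffunE big1 => [|j _]; rewrite ?mulr0n //= subr0 sub0r.
have sum_t : s *+ n = (\sum_i t i) *+ (k - 1)
    - (\sum_i \sum_j d i j) *+ (k - 1) + \sum_i path_moment D i.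
  rewrite -[n in LHS]card_ord -sumr_const -!sumrMnl -sumrB -big_split /=.
  by apply: eq_bigr => i _; rewrite -(t_def i) -moment_compl; ring.
move: D0 s_sum; rewrite /divisor_deg hinge_sum mulrnDr sum_t => D0 s_sum.
rewrite laplacian_x; under eq_bigr do rewrite fx.
(* The sum of the [t i] is known only through its multiple by [k - 1], so the equation at x is
   multiplied by [k - 1]. *)
rewrite sumrN !ffunE /=; apply: (@pmulrnI _ (k - 1)); first by lia.
have {}D0 : D (inl true) + D (inl false) + \sum_i \sum_j d i j = 0 := D0.
have {D0} -> : D (inl false) = - D (inl true) - \sum_i \sum_j d i j by lia.
have {s_sum} : s *+ (k - 1) =
    \sum_i path_moment D i + D (inl true) *+ (k - 1) -
    ((\sum_i t i) *+ (k - 1) - (\sum_i \sum_j d i j) *+ (k - 1)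
     + \sum_i path_moment D i) by rewrite -s_sum addrK.
rewrite /= sub0r mulrnBl mulNrn => ->; ring.
Qed.

End HingeLaplacian.

(** * From the criterion to the isomorphism *)

(** The bound on [p] matters: ['Z_0] and ['Z_1] are both Z/2. *)
Lemma Zp_intr_eq0 p (z : int) : (1 < p)%N ->
  (z%:~R == 0 :> 'Z_p) = (p%:Z %| z)%Z.
Proof.
move=> p_gt1; have nat_case (a : nat) : (a%:R == 0 :> 'Z_p) = (p %| a)%N.
  by rewrite -val_eqE /= val_Zp_nat.
case: (intP z) => [|a|a]; first by rewrite eqxx dvdz0.
  by rewrite dvdzE -nat_case.
by rewrite rmorphN oppr_eq0 dvdzE abszN -nat_case.
Qed.

(** First isomorphism theorem: [phi] is evaluated on representatives, and the inverse chooses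
    preimages. *)
Lemma critical_group_iso (G : sgraph) (T : zmodType)
    (phi : {additive divisor0 G -> T}) :
  (forall D, (phi D == 0) = (D \in @principal G)) ->
  (forall t, exists D, phi D = t) ->
  exists f : {additive critical_group G -> T}, bijective f.
Proof.
move=> ker_phi surj_phi; pose Q := Quotient.quot (@principal G).
pose f (q : Q) : T := phi (repr q).
have phi_eq D E : (phi D == phi E) = (\pi_Q D == \pi_Q E)%qT.
  by rewrite -subr_eq0 -raddfB ker_phi Quotient.idealrBE.
have f_zmod : zmod_morphism f.
  move=> p q; apply/eqP; rewrite /f -raddfB phi_eq reprK.
  by rewrite raddfB /= !reprK.
have f_surj t : exists q, f q == t.
  have [D <-] := surj_phi t; exists (\pi_Q D)%qT.
  by rewrite phi_eq reprK.
pose fA := GRing.isZmodMorphism.Build (critical_group G) T f f_zmod.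
pose F : {additive critical_group G -> T} := HB.pack f fA.
exists F, (fun t => xchoose (f_surj t)) => [q|t].
  by apply/eqP; have := xchooseP (f_surj (F q)); rewrite phi_eq !reprK.
exact/eqP/(xchooseP (f_surj t)).
Qed.

Lemma critical_group_hinge (k n : nat) (hk : (2 < k)%N) (hn : (1 < n)%N) :
  exists f : {additive critical_group (hinge k n) ->
               ({ffun 'I_(n - 2) -> 'Z_(k - 1)} *
                'Z_((k - 1) * (k - 1 + n)))%type},
    bijective f.
Proof.
have m_gt1 : (1 < k - 1)%N by lia.
set m := (k - 1)%N; set N := (m * (m + n))%N.
have N_gt1 : (1 < N)%N by rewrite /N /m; nia.
have [lt_pen lt_last] : (n - 2 < n)%N /\ (n - 1 < n)%N by lia.
pose pen : 'I_n := Ordinal lt_pen; pose last : 'I_n := Ordinal lt_last.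
pose w (l : 'I_(n - 2)) : 'I_n := widen_ord (leq_subr 2 n) l.
pose A (D : divisor0 (hinge k n)) := path_moment D.
pose Ay (D : divisor0 (hinge k n)) : int := divisor0_val D (inl true).
(* Substituting [s = A D last + q *+ m] into the sum equation of [principalP] turns it into
   [B D = q * N]. *)
pose B D : int := \sum_i A D i + Ay D *+ m - A D last *+ (m + n).
pose phi D : ({ffun 'I_(n - 2) -> 'Z_m} * 'Z_N)%type :=
  ([ffun l => (A D (w l) - A D last)%:~R], (B D)%:~R).
have AB D E i : A (D - E) i = A D i - A E i by apply: path_momentB.
have phiB : zmod_morphism phi.
  move=> D E; congr (_, _).
    apply/ffunP => l; rewrite !ffunE !AB -mulrzBr.
    by congr (_ *~ _); ring.
  rewrite -mulrzBr /B !AB; under eq_bigr do rewrite AB.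
  have -> : Ay (D - E) = Ay D - Ay E by rewrite /Ay !ffunE.
  by rewrite sumrB; congr (_ *~ _); ring.
pose phiA := GRing.isZmodMorphism.Build _ _ phi phiB.
pose Phi : {additive divisor0 (hinge k n) -> _} := HB.pack phi phiA.
apply: (critical_group_iso (phi := Phi)) => [D|[a b]].
- have phi_eq0 : (phi D == 0) =
      [forall l, (m%:Z %| A D (w l) - A D last)%Z] && (N%:Z %| B D)%Z.
    rewrite -[_ == _]/((_ == _) && (_ == _)) /= Zp_intr_eq0 //; congr (_ && _).
    apply/eqP/forallP => [/ffunP phi0 l|phi0]; last apply/ffunP => l.
      by have := phi0 l; rewrite !ffunE => /eqP; rewrite Zp_intr_eq0.
    by rewrite !ffunE; apply/eqP; rewrite Zp_intr_eq0.
  have degD : divisor_deg D = 0 by case: D {phi_eq0} => D /= /eqP.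
  rewrite [LHS]phi_eq0; apply/idP/asboolP => [|/(principalP hk degD)]; last first.
    move=> [s [s_mod s_sum]]; apply/andP; split.
      apply/forallP => l.
      have -> : A D (w l) - A D last = A D (w l) - s - (A D last - s) by ring.
      exact: rpredB (s_mod _) (s_mod _).
    have /dvdzP[q q_def] := s_mod last.
    apply/dvdzP; exists (- q).
    by rewrite /B -s_sum -mulrnBl -opprB q_def /N PoszM -mulr_natr natz; ring.
  case/andP => /forallP A_mod /dvdzP[q q_def]; apply/(principalP hk degD).
  exists (A D last + q *+ m).
  have sum_eq : (A D last + q *+ m) *+ (m + n) = \sum_i A D i + Ay D *+ m.
    move/eqP: q_def; rewrite /B subr_eq => /eqP->.
    by rewrite /N; ring.
  split=> // i.
  have A_diff j : j != pen -> (m%:Z %| A D j - A D last)%Z.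
    have [->|] := eqVneq j last; first by rewrite subrr dvdz0.
    rewrite -!val_eqE /= => neq_last neq_pen.
    have lt_j : (j < n - 2)%N by have := ltn_ord j; lia.
    by rewrite (_ : j = w (Ordinal lt_j)) ?A_mod //; apply: val_inj.
  have dvd_m z : (m%:Z %| z *+ m)%Z by rewrite -mulr_natr natz dvdz_mull.
  rewrite opprD addrA rpredB //.
  have [->|/A_diff//] := eqVneq i pen.
  (* No component of [phi] records the path [pen]: by the sum equation [m] divides the total of the
     differences, and it divides all the other terms. *)
  have : (m%:Z %| \sum_j (A D j - A D last))%Z.
    rewrite sumrB sumr_const card_ord.
    rewrite (_ : _ - _ = (A D last + q *+ (m + n) - Ay D) *+ m) //.
    by rewrite -[\sum_j _](addrK (Ay D *+ m)) -sum_eq; ring.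
  rewrite (bigD1 pen) //= rpredDr // rpred_sum //.
(* Prescribe [a] on the first [n - 2] paths and 0 on [last]; the moment at [pen] is then adjusted so
   that the total, which equals [B] here, is [b]. *)
pose c0 (i : 'I_n) : int := if insub (val i) is Some l then a l : nat else 0.
pose c i := if i == pen then (b : nat)%:Z - \sum_(j | j != pen) c0 j else c0 i.
have [D [D0 Dy Dc]] := path_moment_surj hk c.
have DP : deg0 D by apply/eqP.
exists (Divisor0 DP).
have c_last : c last = 0.
  rewrite /c -val_eqE /= /c0 insubF ?ifF //=; lia.
rewrite -[LHS]/(phi _) /phi /B /A /Ay /= !Dc Dy c_last; congr (_, _).
  apply/ffunP => l; rewrite ffunE Dc /c -val_eqE /= /c0 /=.
  by rewrite ltn_eqF // valK subr0 -pmulrn natr_Zp.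
rewrite mul0rn addr0 mul0rn subr0 (eq_bigr c) // (bigD1 pen) //=.
rewrite /c eqxx (eq_bigr c0) => [|j /negbTE ->//].
by rewrite subrK -pmulrn natr_Zp.
Qed.

Local Close Scope ring_scope.

Theorem theorem3p5 (k n : nat) (hk : 3 <= k) (hn : 2 <= n) :
  exists f : {additive critical_group (hinge k n) ->
               ({ffun 'I_(n - 2) -> 'Z_(k - 1)} *
                'Z_(k ^ 2 + n * k - 2 * k - n + 1))%type},
    bijective f.
Proof.
(* Since [3 <= k], none of the natural-number subtractions truncates. *)
have -> : k ^ 2 + n * k - 2 * k - n + 1 = (k - 1) * (k - 1 + n) by nia.
exact: critical_group_hinge.
Qed.
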